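(* Let $\mathbb H$ be a Hilbert space with inner product $\langle\cdot,\cdot\rangle_{\mathbb H}$ and corresponding norm $\|\cdot\|_{\mathbb H}$, and let $\Lambda\subseteq\mathbb H$ be a nonempty closed and convex set. Let $\theta_0\in\mathbb H$, and suppose there are maps $\hat\theta_n:\{X_i\}_{i=1}^n\to\mathbb H$ such that, for some $r_n\uparrow\infty$, $r_n\{\hat\theta_n-\theta_0\}\stackrel{L}{\to}\mathbb G_0$ in $\mathbb H$, where $\mathbb G_0$ is tight. Let $\phi'_{\theta_0}(h)\equiv\|h-\Pi_{T_{\theta_0}}h\|_{\mathbb H}$ for $h\in\mathbb H$, and for a sequence $\epsilon_n>0$ define $$\hat\phi_n'(h)\equiv\sup_{\theta\in\Lambda:\,\|\theta-\Pi_\Lambda\hat\theta_n\|_{\mathbb H}\le\epsilon_n}\|h-\Pi_{T_\theta}h\|_{\mathbb H},\qquad h\in\mathbb H.$$ Then: (i) If $\epsilon_n\downarrow0$ and $\epsilon_nr_n\uparrow\infty$, then for every compact set $K\subseteq\mathbb H$, with $K^\delta\equiv\{a\in\mathbb H:\inf_{b\in K}\|a-b\|_{\mathbb H}<\delta\}$, and every $\epsilon>0$, $$\lim_{\delta\downarrow0}\limsup_{n\to\infty}P\Big(\sup_{h\in K^\delta}|\hat\phi_n'(h)-\phi'_{\theta_0}(h)|>\epsilon\Big)=0.$$ (ii) $\phi'_{\theta_0}(h_1+h_2)\le\phi'_{\theta_0}(h_1)+\phi'_{\theta_0}(h_2)$ for all $h_1,h_2\in\mathbb H$.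
   Context: For a closed convex nonempty set $C\subseteq\mathbb H$, $\Pi_C:\mathbb H\to C$ is the metric projection, $\|\theta-\Pi_C\theta\|_{\mathbb H}=\inf_{h\in C}\|\theta-h\|_{\mathbb H}$. The tangent cone of $\Lambda$ at $\theta\in\mathbb H$ is $T_\theta\equiv\overline{\bigcup_{\alpha\ge0}\alpha\{\Lambda-\Pi_\Lambda\theta\}}$, where $\alpha\{\Lambda-\Pi_\Lambda\theta\}=\{\alpha(\lambda-\Pi_\Lambda\theta):\lambda\in\Lambda\}$ and the closure is under $\|\cdot\|_{\mathbb H}$; it is a closed convex set. $\hat\theta_n:\{X_i\}_{i=1}^n\to\mathbb H$ means $\hat\theta_n$ is a (not necessarily measurable) function of the data $\{X_i\}_{i=1}^n$. Convergence in distribution $\stackrel{L}{\to}$ is in the Hoffman-Jørgensen sense: $Z_n\stackrel{L}{\to}Z$ ($Z$ Borel) means $E^*[f(Z_n)]\to E[f(Z)]$ for all bounded continuous real $f$, where $E^*$ is outer expectation. Probabilities of possibly nonmeasurable events are outer probabilities. $\mathbb G_0$ is a Borel random element of $\mathbb H$. *)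

(* Defs.v *)
From HB Require Import structures.
From mathcomp Require Import all_boot all_order all_algebra.
From mathcomp Require Import all_classical all_reals all_analysis.
From mathcomp Require Import measurable_realfun.

Set Implicit Arguments.
Unset Strict Implicit.
Unset Printing Implicit Defensive.

Import Order.TTheory GRing.Theory Num.Theory.
Import numFieldNormedType.Exports.

Local Open Scope classical_set_scope.
Local Open Scope ring_scope.

Section Geometry.
Context {R : realType} {H : completeNormedModType R}.
Implicit Types (C L K : set H) (h t : H).

(* With the completeness of H this makes H a real Hilbert space. *)
Definition induces_norm (dot : {dot H for idfun}) : Prop :=
  forall x : H, dot x x = `|x| ^+ 2.

(* The nearest point of C to h.  For a closed convex nonempty set C of a
   Hilbert space it exists and is unique; the default 0 only serves to make
   the operation total in C. *)
Definition metric_projection C h : H :=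
  xget 0 [set c | C c /\ `|h - c| = inf [set `|h - c'| | c' in C]].

Definition tangent_cone L t : set H :=
  closure (\bigcup_(a in [set a : R | 0 <= a])
    [set a *: (l - metric_projection L t) | l in L]).

Definition dphi L t h : R :=
  `|h - metric_projection (tangent_cone L t) h|.

(* The supremum is that of a set of reals which, for 0 < eps, is nonempty and
   bounded by `|h|, as tangent cones contain 0. *)
Definition dphi_hat L (eps : R) (that : H) h : R :=
  sup [set dphi L t h | t in
    [set t | L t /\ `|t - metric_projection L that| <= eps]].

(* The infimum is taken in \bar R, so that the enlargement of set0 is set0. *)
Definition enlargement K (delta : R) : set H :=
  [set a | (ereal_inf [set `|a - b|%:E | b in K] < delta%:E)%E].

End Geometry.

Section OuterProbability.
Context {d : measure_display} {T : measurableType d} {R : realType}.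
Variable P : probability T R.

Definition outer_probability (A : set T) : \bar R :=
  ereal_inf [set P B | B in [set B | measurable B /\ A `<=` B]].

(* The majorants U range over the measurable functions whose expectation
   exists in \bar R, i.e. is not of the form +oo - +oo. *)
Definition outer_expectation (f : T -> \bar R) : \bar R :=
  ereal_inf [set (\int[P]_w U w)%E | U in [set U : T -> \bar R |
    [/\ measurable_fun setT U,
        (\int[P]_w U^\+ w < +oo)%E \/ (\int[P]_w U^\- w < +oo)%E
      & forall w, (f w <= U w)%E]]].

End OuterProbability.

Definition borel {R : realType} (H : completeNormedModType R) :=
  g_sigma_algebraType (@open H).

Section WeakConvergence.
Context {R : realType} {H : completeNormedModType R}.
Context {d : measure_display} {T : measurableType d} (P : probability T R).
Context {d' : measure_display} {T' : measurableType d'} (Q : probability T' R).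

(* Convergence in distribution in the sense of Hoffmann-Jorgensen: the maps
   Z n are arbitrary, only the limit G is Borel. *)
Definition cvg_in_distribution (Z : nat -> T -> H) (G : {RV Q >-> borel H}) :
    Prop :=
  forall f : H -> R, continuous f -> bounded_fun f ->
    outer_expectation P (fun w => (f (Z n w))%:E) @[n --> \oo]
      --> (\int[Q]_w (f (G w))%:E)%E.

Definition tight (G : {RV Q >-> borel H}) : Prop :=
  forall e : R, 0 < e ->
    exists2 K : set H, compact K & ((1 - e)%:E <= Q (G @^-1` K))%E.

End WeakConvergence.

(* Main.v *)
(* As T_theta is a closed convex cone, dphi L theta h is the distance from h to
   T_theta; it is subadditive in h because the cone is closed under addition,
   and hence 1-Lipschitz because it is at most |h|.  For fixed h it is upper
   semicontinuous in theta along Lambda: if a (l - theta0) is almost optimal in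
   T_theta0, then a (l - theta) is in T_theta and is almost as good for theta
   close to theta0.  Compactness and the Lipschitz property make this uniform on
   small enlargements of K.  On the event |thetahat_n - theta0| <= eps_n the
   projection of theta0 is admissible in the supremum defining dphi_hat, by
   nonexpansiveness of projections, so that dphi_hat lies between dphi and
   dphi + e.  The complement of this event has vanishing outer probability:
   Markov's inequality for outer expectations applies to a continuous truncation
   of |r_n (thetahat_n - theta0)|, whose limit is controlled by tightness. *)
Require Import Defs.
From HB Require Import structures.
From mathcomp Require Import all_boot all_order all_algebra.
From mathcomp Require Import all_classical all_reals all_analysis.
From mathcomp Require Import measurable_realfun ring lra.

Set Implicit Arguments.
Unset Strict Implicit.
Unset Printing Implicit Defensive.

Import Order.TTheory GRing.Theory Num.Theory.
Import numFieldNormedType.Exports.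

Local Open Scope classical_set_scope.
Local Open Scope ring_scope.

(** * Nearest points in a Hilbert space *)

Section HilbertProjection.
Context {R : realType} {H : completeNormedModType R}.
Context (dot : {dot H for idfun}) (Hdot : induces_norm dot).
Implicit Types (C : set H) (h x y : H).

Lemma normD_sq x y : `|x + y| ^+ 2 = `|x| ^+ 2 + `|y| ^+ 2 + 2 * dot x y.
Proof.
have /= := hnormD dot x y; rewrite !Hdot expr0 mul1r => ->.
by rewrite mulr_natl mulr2n.
Qed.

Lemma normB_sq x y : `|x - y| ^+ 2 = `|x| ^+ 2 + `|y| ^+ 2 - 2 * dot x y.
Proof. by rewrite normD_sq normrN linearNr mulrN. Qed.

Lemma parallelogram x y :
  `|x + y| ^+ 2 + `|x - y| ^+ 2 = 2 * (`|x| ^+ 2 + `|y| ^+ 2).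
Proof. by rewrite normD_sq normB_sq; ring. Qed.

(** The form of convexity that the parallelogram law calls for. Tangent cones satisfy it through
    closure under sums and positive multiples. *)
Definition midpoint_closed C := forall x y, C x -> C y -> C (2^-1 *: (x + y)).

Lemma inf_dist_le C h c : C c -> inf [set `|h - c'| | c' in C] <= `|h - c|.
Proof.
by move=> Cc; apply: ge_inf; [exists 0 => _ [c' _ <-] | exists c].
Qed.

(* By the parallelogram law, the sets of almost nearest points of C form a Cauchy
   filter; its limit is the nearest point. *)
Lemma nearest_point_ex C h : closed C -> C !=set0 -> midpoint_closed C ->
  exists c, C c /\ `|h - c| = inf [set `|h - c'| | c' in C].
Proof.
move=> Ccl C0 Cmid; set d := inf _.
have d0 : 0 <= d.
  apply: lb_le_inf; last by move=> _ [c' _ <-].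
  by have [c Cc] := C0; exists `|h - c|, c.
pose B (e : R) := C `&` [set c | `|h - c| < d + e].
have Bne e : 0 < e -> B e !=set0.
  move=> e0; have [|_ [c Cc <-] lt_c] := @inf_adherent _ [set `|h - c'| | c' in C] e e0.
    split; last by exists 0 => _ [c' _ <-].
    by have [c Cc] := C0; exists `|h - c|, c.
  by exists c; split.
(* The midpoint of [x] and [y] lies in [C], hence at distance at least [d] from [h]; the
   parallelogram law then bounds [x - y]. *)
have Bsq e x y : B e x -> B e y -> `|x - y| ^+ 2 <= 4 * (2 * d * e + e ^+ 2).
  move=> [Cx lx] [Cy ly]; have := parallelogram (h - x) (h - y).
  have -> : h - x - (h - y) = - (x - y) by rewrite !opprB addrCA addrAC subrr add0r.
  rewrite normrN.
  have -> : h - x + (h - y) = 2 *: (h - 2^-1 *: (x + y)).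
    rewrite scalerBr scalerA divff ?pnatr_eq0// scale1r scaler_nat mulr2n.
    by rewrite opprD addrACA.
  rewrite normrZ exprMn ger0_norm//.
  have dm := inf_dist_le h (Cmid _ _ Cx Cy); rewrite -/d in dm.
  have sqm : d ^+ 2 <= `|h - 2^-1 *: (x + y)| ^+ 2 by rewrite lerXn2r ?nnegrE.
  have de0 : 0 <= d + e by apply: le_trans (ltW lx).
  have sqx : `|h - x| ^+ 2 <= (d + e) ^+ 2 by rewrite lerXn2r ?nnegrE// ltW.
  have sqy : `|h - y| ^+ 2 <= (d + e) ^+ 2 by rewrite lerXn2r ?nnegrE// ltW.
  by move=> E; lra.
pose F := filter_from [set e : R | 0 < e] B.
have FF : ProperFilter F.
  apply: filter_from_proper; last by move=> e; exact: Bne.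
  apply: filter_from_filter; first by exists 1; rewrite /= ltr01.
  move=> i j /= i0 j0; exists (Num.min i j) => /=; first by rewrite lt_min i0.
  move=> x [Cx lx]; split; split=> //=; apply: lt_le_trans lx _; rewrite lerD2l.
    by rewrite ge_min lexx.
  by rewrite ge_min lexx orbT.
have Fc : cvg F.
  apply/cauchy_cvgP; apply: cauchy_exP => e e0.
  (* As [k <= 1], the bound in [Bsq] is at most [4 * (2 * d + 1) * k], which is less than
     [e ^+ 2]. *)
  pose k := Num.min 1 (e ^+ 2 / (4 * (2 * d + 2))).
  have D0 : 0 < 4 * (2 * d + 2) by lra.
  have k0 : 0 < k by rewrite lt_min ltr01 divr_gt0// exprn_gt0.
  have [x Bx] := Bne _ k0; exists x; exists k => //= y By.
  rewrite -ball_normE /=; rewrite -(@ltr_pXn2r _ 2)// ?nnegrE// ?(ltW e0)//.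
  apply: le_lt_trans (Bsq _ _ _ Bx By) _.
  have k1 : k <= 1 by rewrite ge_min lexx.
  have : k <= e ^+ 2 / (4 * (2 * d + 2)) by rewrite ge_min lexx orbT.
  rewrite ler_pdivlMr// => ke.
  have kk : k ^+ 2 <= k by rewrite expr2 ler_piMl// ltW.
  by move: k0 k1 ke kk; clearbody k; nra.
exists (lim F).
have Cl : C (lim F).
  apply: (@closed_cvg _ _ F _ id C Ccl); last exact: Fc.
  by exists 1 => [/=|x []]; rewrite ?ltr01.
split=> //; apply/eqP; rewrite eq_le inf_dist_le// andbT.
apply/ler_addgt0Pr => e e0.
apply: (@closed_cvg _ _ F _ id _ (@closed_closed_ball_ _ _ h (d + e))).
  by exists e => // x [_ /=] /ltW.
exact: Fc.
Qed.

Lemma metric_projectionP C h : closed C -> C !=set0 -> midpoint_closed C ->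
  C (metric_projection C h) /\
  forall c, C c -> `|h - metric_projection C h| <= `|h - c|.
Proof.
move=> Ccl C0 Cmid; have [c Pc] := nearest_point_ex h Ccl C0 Cmid.
rewrite /metric_projection; case: xgetP => [p _ [Cp Ep]|/(_ c)//].
by split=> // c' Cc'; rewrite [leLHS]Ep; exact: inf_dist_le.
Qed.

End HilbertProjection.

Lemma convex_combination (R : realType) (H : completeNormedModType R)
    (L : set H) (x y : H) (s : R) :
  convex_set L -> L x -> L y -> 0 <= s -> s <= 1 -> L (s *: x + (1 - s) *: y).
Proof.
move=> Lconvex Lx Ly s0 s1.
have := Lconvex x y (Itv01 s0 s1); rewrite !inE; apply=> //.
Qed.

Lemma closure_normP (R : realType) (H : completeNormedModType R)
    (A : set H) (x : H) :
  closure A x <-> forall e : R, 0 < e -> exists2 a, A a & `|x - a| < e.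
Proof.
split=> [clA e e0|clA B /nbhs_ballP[e /= e0 eB]].
  by have [a [Aa]] := clA _ (nbhsx_ballx x e e0); rewrite -ball_normE; exists a.
by have [a Aa xa] := clA _ e0; exists a; split=> //; apply: eB; rewrite -ball_normE.
Qed.

(** * Projection onto [L], its tangent cones and the distance to them *)

Section TangentCone.
Context {R : realType} {H : completeNormedModType R}.
Context (dot : {dot H for idfun}) (Hdot : induces_norm dot).
Context (L : set H) (L0 : L !=set0) (Lclosed : closed L) (Lconvex : convex_set L).
Implicit Types (t h x y : H).

Let proj := metric_projection L.

Lemma proj_spec h : L (proj h) /\ forall c, L c -> `|h - proj h| <= `|h - c|.
Proof.
apply: (metric_projectionP Hdot) => // x y Lx Ly.
have -> : 2^-1 *: (x + y) = 2^-1 *: x + (1 - 2^-1) *: y.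
  by rewrite scalerDr; congr (_ + _ *: _); field.
by apply: convex_combination => //; lra.
Qed.

Lemma proj_id t : L t -> proj t = t.
Proof.
move=> Lt; have [_ /(_ t Lt)] := proj_spec t.
by rewrite subrr normr0 normr_le0 subr_eq0 => /eqP.
Qed.

(** Moving from [proj h] towards [c] by a fraction [s] changes the squared distance to [h] by
    [s * (s * N - 2 * k)], which is negative for small [s] if [k > 0]. *)
Lemma proj_variational h c : L c -> dot (h - proj h) (c - proj h) <= 0.
Proof.
move=> Lc; have [Lp minp] := proj_spec h; rewrite leNgt; apply/negP.
set u := h - proj h in minp *; set v := c - proj h; set k := dot u v => k0.
pose N := `|v| ^+ 2; have N0 : 0 <= N by rewrite exprn_ge0.
have D0 : 0 < k + N + 1 by lra.
(* This choice gives both [s <= 1] and [s * N < k]. *)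
pose s := k / (k + N + 1).
have s0 : 0 < s by rewrite divr_gt0.
have s1 : s <= 1 by rewrite ler_pdivrMr// mul1r; lra.
have Lq := convex_combination Lconvex Lc Lp (ltW s0) s1.
have := minp _ Lq.
have -> : h - (s *: c + (1 - s) *: proj h) = u - s *: v.
  rewrite /u /v scalerBr scalerBl scale1r [s *: c + _]addrCA.
  by rewrite opprD addrA.
rewrite -(@ler_pXn2r _ 2)// ?nnegrE// (normB_sq Hdot u (s *: v)).
have -> : dot u (s *: v) = s * k by rewrite linearZr_LR.
have -> : `|s *: v| ^+ 2 = s ^+ 2 * N by rewrite normrZ exprMn (gtr0_norm s0).
have sD : s * (k + N + 1) = k by rewrite divfK ?gt_eqF.
have sk : 0 < s * k by rewrite mulr_gt0.
move=> le_u; have : 0 <= s * (s * N - 2 * k) by clearbody s; lra.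
by rewrite pmulr_rge0//; clearbody s; lra.
Qed.

(** Testing the variational inequality of each projection against the other one makes the cross term
    in the expansion of [|x - y| ^+ 2] nonnegative. *)
Lemma proj_nonexpansive x y : `|proj x - proj y| <= `|x - y|.
Proof.
have [[Lx _] [Ly _]] := (proj_spec x, proj_spec y).
have := proj_variational x Ly; have := proj_variational y Lx.
set p := proj x; set q := proj y => vy vx.
rewrite -(@ler_pXn2r _ 2)// ?nnegrE//.
have E : x - y = (p - q) + ((x - p) - (y - q)).
  by rewrite opprB addrACA subrKC addKr.
rewrite E (normD_sq Hdot (p - q) (x - p - (y - q))).
have -> : dot (p - q) (x - p - (y - q)) = dot (p - q) (x - p) - dot (p - q) (y - q).
  by rewrite linearBr.
have -> : dot (p - q) (x - p) = - dot (x - p) (q - p).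
  by rewrite (hermC dot) expr0 mul1r /= -linearNr opprB.
have -> : dot (p - q) (y - q) = dot (y - q) (p - q).
  by rewrite (hermC dot) expr0 mul1r.
have := sqr_ge0 `|(x - p) - (y - q)|; lra.
Qed.

Lemma tangent_cone_elt t l (a : R) :
  L l -> 0 <= a -> tangent_cone L t (a *: (l - proj t)).
Proof. by move=> Ll a0; apply: subset_closure; exists a => //; exists l. Qed.

Lemma tangent_cone0 t : tangent_cone L t 0.
Proof. by have [l Ll] := L0; rewrite -(scale0r (l - proj t)); apply: tangent_cone_elt. Qed.

(** With [p := proj t], the sum of [a *: (l - p)] and [b *: (m - p)] is [a + b] times [q - p], where
    [q] is the convex combination of [l] and [m] with weights proportional to [a] and [b]. The case
    [a + b = 0] is separate. *)
Lemma tangent_coneD t x y :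
  tangent_cone L t x -> tangent_cone L t y -> tangent_cone L t (x + y).
Proof.
move=> /closure_normP Tx /closure_normP Ty; apply/closure_normP => e e0.
have e2 : 0 < e / 2 by rewrite divr_gt0.
have [_ [a /= a0 [l Ll <-]] xa] := Tx _ e2.
have [_ [b /= b0 [m Lm <-]] yb] := Ty _ e2.
exists (a *: (l - proj t) + b *: (m - proj t)); last first.
  rewrite opprD addrACA (le_lt_trans (ler_normD _ _))//.
  by rewrite [ltRHS](splitr e) ltrD.
have [ab0|ab0] := eqVneq (a + b) 0.
  have [-> ->] : a = 0 /\ b = 0 by split; lra.
  by exists 0 => //=; exists l; rewrite ?scale0r ?addr0.
exists (a + b) => /=; first exact: addr_ge0.
have abgt0 : 0 < a + b by rewrite lt0r ab0 addr_ge0.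
exists (a / (a + b) *: l + (1 - a / (a + b)) *: m).
  apply: convex_combination => //; first by rewrite divr_ge0// ltW.
  by rewrite ler_pdivrMr// mul1r lerDl.
have -> : 1 - a / (a + b) = b / (a + b) by field.
rewrite scalerBr scalerDr !scalerA ![(a + b) * _]mulrC !divfK// scalerDl.
by rewrite !scalerBr opprD addrACA.
Qed.

Lemma tangent_cone_scale t x (s : R) :
  0 < s -> tangent_cone L t x -> tangent_cone L t (s *: x).
Proof.
move=> s0 /closure_normP Tx; apply/closure_normP => e e0.
have [|_ [a /= a0 [l Ll <-]] xa] := Tx (e / s); first exact: divr_gt0.
exists (s *: (a *: (l - proj t))).
  by rewrite scalerA; exists (s * a) => /=; [rewrite mulr_ge0// ltW|exists l].
by rewrite -scalerBr normrZ gtr0_norm// mulrC -ltr_pdivlMr.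
Qed.

Lemma dphi_spec t h : tangent_cone L t (metric_projection (tangent_cone L t) h) /\
  forall c, tangent_cone L t c -> dphi L t h <= `|h - c|.
Proof.
apply: (metric_projectionP Hdot); first exact: closed_closure.
  by exists 0; exact: tangent_cone0.
by move=> x y Tx Ty; apply: tangent_cone_scale => //; apply: tangent_coneD.
Qed.

Lemma dphi_le_norm t h : dphi L t h <= `|h|.
Proof. by have [_ /(_ _ (tangent_cone0 t))] := dphi_spec t h; rewrite subr0. Qed.

(** The sum of the projections of [x] and [y] lies in the cone and competes with the projection of
    [x + y]. *)
Lemma dphi_subadditive t x y : dphi L t (x + y) <= dphi L t x + dphi L t y.
Proof.
have [[Tx _] [Ty _]] := (dphi_spec t x, dphi_spec t y).
have [_ /(_ _ (tangent_coneD Tx Ty)) /le_trans] := dphi_spec t (x + y); apply.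
by rewrite opprD addrACA ler_normD.
Qed.

Lemma dphi_lipschitz t x y : dphi L t x <= dphi L t y + `|x - y|.
Proof.
rewrite -{1}(subrKC y x) (le_trans (dphi_subadditive _ _ _))//.
by rewrite lerD2l dphi_le_norm.
Qed.

Lemma dphi_usc t0 h (eta : R) : L t0 -> 0 < eta ->
  exists2 delta : R, 0 < delta & forall t, L t -> `|t - t0| <= delta ->
    dphi L t h <= dphi L t0 h + eta.
Proof.
move=> Lt0 eta0; have e2 : 0 < eta / 2 by rewrite divr_gt0.
have [/closure_normP/(_ _ e2)[_ [a /= a0 [l Ll <-]] pa] _] := dphi_spec t0 h.
have a1 : 0 < a + 1 by rewrite ltr_wpDl.
(* Half of [eta] pays for near optimality at [t0], the other half for [a * |t - t0|]; [a + 1] avoids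
   division by zero. *)
exists (eta / 2 / (a + 1)) => [|t Lt tt0]; first by rewrite divr_gt0.
have [_ /(_ _ (@tangent_cone_elt t _ _ Ll a0)) /le_trans] := dphi_spec t h; apply.
move: pa; rewrite -/proj !proj_id//.
set p := metric_projection _ _ => pa.
have -> : h - a *: (l - t) = (h - p) + (p - a *: (l - t0)) + a *: (t - t0).
  rewrite addrA subrK -addrA; congr (_ + _).
  by rewrite -!scalerN -scalerDr !opprB [in RHS]addrC addrA subrK.
have aw : a * `|t - t0| <= eta / 2.
  rewrite ler_pdivlMr// in tt0; apply: le_trans tt0.
  by rewrite mulrC ler_wpM2l// lerDl.
apply: le_trans (ler_normD _ _) _; rewrite normrZ ger0_norm//.
have := ler_normD (h - p) (p - a *: (l - t0)).
by rewrite /dphi -/p; lra.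
Qed.

(** The pointwise [delta] at [h] also serves a ball around [h], so by compactness a single one
    serves [K]. One third of [eta] goes to the pointwise bound and one to each of two Lipschitz
    estimates. *)
Lemma dphi_usc_compact (K : set H) t0 (eta : R) : compact K -> L t0 -> 0 < eta ->
  exists2 delta : R, 0 < delta & forall t h, L t -> `|t - t0| <= delta -> K h ->
    dphi L t h <= dphi L t0 h + eta.
Proof.
move=> Kc Lt0 eta0; have e3 : 0 < eta / 3 by rewrite divr_gt0.
pose P (delta : R) h :=
  forall t, L t -> `|t - t0| <= delta -> dphi L t h <= dphi L t0 h + eta.
have : \forall delta \near 0^'+, K `<=` P delta.
  move/compact_near_coveringP : Kc; apply=> h Kh.
  have [delta d0 Pd] := dphi_usc h Lt0 e3.
  exists (ball h (eta / 3), [set e | e <= delta]) => /=.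
    split; first exact: nbhsx_ballx.
    by exact: nbhs_right_le.
  move=> [h' e] /= []; rewrite -ball_normE /= => hh' le_e t Lt tt0.
  have := Pd t Lt (le_trans tt0 le_e); move: hh'.
  have := dphi_lipschitz t h' h; have := dphi_lipschitz t0 h h'.
  rewrite (distrC h' h); move: `|h - h'| (dphi L t h) (dphi L t h').
  by move: (dphi L t0 h) (dphi L t0 h') => a b c a' b'; lra.
move=> nearP; have [delta [d0 Pd]] := filter_ex (filterI (nbhs_right_gt 0) nearP).
by exists delta => // t h Lt tt0 Kh; exact: Pd.
Qed.

(** This reduces an arbitrary [theta0] to a point of [L], where semicontinuity is available. *)
Lemma tangent_cone_proj t : tangent_cone L (proj t) = tangent_cone L t.
Proof.
by rewrite /tangent_cone -/proj proj_id//; have [] := proj_spec t.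
Qed.

(* The enlargement costs 2 delta <= e / 2 by the Lipschitz property of dphi in h. *)
Lemma dphi_hat_approx (K : set H) theta0 (e : R) : compact K -> 0 < e ->
  exists2 eps0 : R, 0 < eps0 & forall (eps delta : R) that h,
    0 < eps -> eps <= eps0 -> `|that - theta0| <= eps -> delta <= e / 4 ->
    enlargement K delta h -> `|dphi_hat L eps that h - dphi L theta0 h| <= e.
Proof.
move=> Kc e0; have e2 : 0 < e / 2 by rewrite divr_gt0.
pose t0 := proj theta0; have [Lt0 _] := proj_spec theta0.
have dphiE x : dphi L theta0 x = dphi L t0 x by rewrite /dphi tangent_cone_proj.
have [eps1 eps1_gt0 usc] := dphi_usc_compact Kc Lt0 e2.
(* An admissible [t] is within [eps] of [proj that], itself within [eps] of [t0]; hence the factor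
   2. *)
exists (eps1 / 2) => [|eps delta that h eps_gt0 le_eps near_that de Kh].
  by rewrite divr_gt0.
have [b Kb hb] : exists2 b, K b & `|h - b| < delta.
  apply: contrapT => nb; move: Kh; rewrite /enlargement /= ltNge => /negP; apply.
  apply: le_ereal_inf_tmp => _ [b Kb <-]; rewrite lee_fin leNgt.
  by apply/negP => hb; apply: nb; exists b.
have near_proj : `|t0 - proj that| <= eps.
  by rewrite distrC (le_trans (proj_nonexpansive _ _)).
rewrite dphiE /dphi_hat; set D := image _ _.
have D0 : D (dphi L t0 h) by exists t0.
have Dub : ubound D (dphi L t0 h + e).
  move=> _ [t [Lt tp] <-].
  have tt0 : `|t - t0| <= eps1.
    by have := ler_distD (proj that) t t0; rewrite (distrC (proj that)); lra.
  have := usc _ _ Lt tt0 Kb.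
  have := dphi_lipschitz t h b; have := dphi_lipschitz t0 b h.
  rewrite (distrC b h); move: (dphi L t h) (dphi L t b) (dphi L t0 b) => x y z.
  by move: (dphi L t0 h) => u; lra.
have le_sup : dphi L t0 h <= sup D by apply: ub_le_sup => //; exists (dphi L t0 h + e).
have sup_le : sup D <= dphi L t0 h + e by apply: ge_sup => //; exists (dphi L t0 h).
by rewrite ger0_norm ?subr_ge0// lerBlDl.
Qed.

End TangentCone.

(** * Outer probability and outer expectation *)

Section OuterProbabilityTheory.
Context {d : measure_display} {T : measurableType d} {R : realType}.
Context (P : probability T R).
Implicit Types (A B : set T).

Lemma outer_probability_ge0 A : (0 <= outer_probability P A)%E.
Proof. by apply: le_ereal_inf_tmp => _ [B [mB AB] <-]. Qed.

Lemma le_outer_probability A B : A `<=` B ->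
  (outer_probability P A <= outer_probability P B)%E.
Proof.
move=> AB; apply: ereal_inf_le_tmp => _ [C [mC BC] <-].
by exists C => //; split=> //; exact: subset_trans BC.
Qed.

(** For each measurable majorant [U] of [f], the measurable set where [1 <= U] covers [A], and its
    indicator is at most [U]. *)
Lemma outer_markov A (f : T -> \bar R) : (forall w, 0 <= f w)%E ->
  (forall w, A w -> 1 <= f w)%E ->
  (outer_probability P A <= outer_expectation P f)%E.
Proof.
move=> f0 f1; apply: le_ereal_inf_tmp => _ [U [mU _ fU] <-].
have U0 w : (0 <= U w)%E := le_trans (f0 w) (fU w).
have mB : measurable [set w | (1 <= U w)%E].
  have := emeasurable_fun_c_infty measurableT mU 1%E; rewrite setTI; exact.
apply: (@le_trans _ _ (P [set w | (1 <= U w)%E])).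
  apply: ereal_inf_lbound; exists [set w | (1 <= U w)%E] => //.
  by split=> // w Aw /=; apply: le_trans (fU w); exact: f1.
rewrite -[X in P X]setIT -(integral_indic _ measurableT)//; apply: ge0_le_integral => //.
- exact/measurable_EFinP/measurable_indic.
- by move=> w _; rewrite indicE; case: (boolP (w \in _)) => [|_ //=]; rewrite inE.
Qed.

End OuterProbabilityTheory.

(** * Tail bounds from weak convergence to a tight limit *)

Section Tightness.
Context {R : realType} {H : completeNormedModType R}.
Context {d : measure_display} {T : measurableType d} (P : probability T R).
Context {d' : measure_display} {T' : measurableType d'} (Q : probability T' R).

Lemma measurable_preimage_open (G : {RV Q >-> borel H}) (U : set H) :
  open U -> measurable (G @^-1` U).
Proof.
move=> oU; rewrite -[X in measurable X]setTI.
by apply: (measurable_funPT G) => //; apply: sub_sigma_algebra.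
Qed.

Lemma measurable_continuous_RV (G : {RV Q >-> borel H}) (f : H -> R) :
  continuous f -> measurable_fun setT (fun w => f (G w)).
Proof.
move=> cf; apply: (measurability _ (RGenOpens.measurableE R)).
move=> _ [_ [a [b ->] <-]]; rewrite setTI.
have oB : open (f @^-1` `]a, b[%classic).
  by apply: open_comp; [move=> x _; exact: cf|exact: interval_open].
exact: (measurable_preimage_open G oB).
Qed.

(** A continuous substitute for the indicator of a tail: 0 where the norm is at most [M], 1 where it
    is at least [M + 1]. *)
Definition ramp (M : R) (x : H) : R := Num.min 1 (Num.max 0 (`|x| - M)).

Lemma ramp_ge0 M x : 0 <= ramp M x.
Proof. by rewrite le_min ler01 le_max lexx. Qed.

Lemma ramp_le1 M x : ramp M x <= 1.
Proof. by rewrite ge_min lexx. Qed.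

Lemma continuous_ramp M : continuous (ramp M).
Proof.
have c0 : continuous (fun x : H => `|x| - M : R^o).
  by move=> x; apply: cvgB; [exact: norm_continuous|exact: cvg_cst].
have c1 : continuous (cst 0 \max (fun x : H => `|x| - M : R^o)).
  by move=> x; apply: continuous_max; [exact: cvg_cst|exact: c0].
have c2 : continuous (cst 1 \min (cst 0 \max (fun x : H => `|x| - M : R^o))).
  by move=> x; apply: continuous_min; [exact: cvg_cst|exact: c1].
exact: c2.
Qed.

Lemma outer_probability_tail (Z : nat -> T -> H) (G : {RV Q >-> borel H})
    (m : nat -> R) (e : R) :
  cvg_in_distribution P Z G -> tight G -> m n @[n --> \oo] --> +oo -> 0 < e ->
  \forall n \near \oo,
    (outer_probability P [set w | m n < `|Z n w|]%R <= e%:E)%E.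
Proof.
move=> ZG Gt moo e0; have e2 : 0 < e / 2 by rewrite divr_gt0.
have [K Kc QK] := Gt _ e2.
have [M [_ KM]] := compact_bounded Kc.
(* [KM] bounds [K] only by numbers strictly above [M], so the ramp starts at [M + 1] and vanishes on
   [K]. *)
pose f := ramp (M + 1).
have fb : bounded_fun f.
  exists 1; split=> // x x1 h _; rewrite /= ger0_norm ?ramp_ge0//.
  by apply: le_trans (ltW x1); exact: ramp_le1.
have mK : measurable (G @^-1` K).
  have oK : open (~` K).
    exact/closed_openC/(compact_closed (@norm_hausdorff _ _) Kc).
  rewrite -[X in measurable X]setTI -[K]setCK preimage_setC -setDE.
  apply: measurableD => //; exact: (measurable_preimage_open G oK).
have Ef : (\int[Q]_w (f (G w))%:E <= (e / 2)%:E)%E.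
  apply: (@le_trans _ _ (Q (~` (G @^-1` K)))); last first.
    by rewrite probability_setC// leeBlDr ?fin_num_measure// -leeBlDl.
  rewrite -[X in Q X]setIT -(integral_indic _ measurableT); last exact: measurableC.
  apply: ge0_le_integral => //.
  - by move=> w _; rewrite lee_fin ramp_ge0.
  - exact/measurable_EFinP/(measurable_continuous_RV G (@continuous_ramp _)).
  - exact/measurable_EFinP/measurable_indic/(measurableC mK).
  - move=> w _; rewrite lee_fin indicE.
    case: (boolP (w \in _)) => [_|]; first exact: ramp_le1.
    rewrite notin_setE => /contrapT /= KGw.
    have GM : `|G w : H| <= M + 1 by apply: KM KGw; rewrite ltrDl.
    by rewrite /f /ramp (max_idPl _) ?subr_le0// (min_idPr _).
have Ez : \forall n \near \oo,
    (outer_expectation P (fun w => (f (Z n w))%:E) < e%:E)%E.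
  have small : nbhs (\int[Q]_w (f (G w))%:E)%E [set y | (y < e%:E)%E].
    apply: open_nbhs_nbhs; split; first exact: open_ereal_lt_ereal.
    by apply: le_lt_trans Ef _; rewrite lte_fin ltr_pdivrMr// ltr_pMr// ltr1n.
  exact: (ZG f (@continuous_ramp _) fb _ small).
(* Beyond [M + 2] the ramp equals 1, as the Markov inequality requires. *)
have m_ge : \forall n \near \oo, M + 2 <= m n by move/cvgryPge : moo; exact.
near=> n; apply: (@le_trans _ _ (outer_expectation P (fun w => (f (Z n w))%:E))).
  apply: outer_markov => w; first by rewrite lee_fin ramp_ge0.
  have Mn : M + 2 <= m n by near: n.
  move=> /= mZ; have Z1 : 1 <= `|Z n w| - (M + 1) by lra.
  by rewrite lee_fin /f /ramp le_min lexx le_max Z1 orbT.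
by apply: ltW; near: n.
Unshelve. all: by end_near. Qed.

End Tightness.

(** The upper limit is an infimum of suprema over neighbourhoods of infinity, and the set where
    [u n <= e%:E] is one of these. *)
Lemma limn_esup_eq0 (R : realType) (u : (\bar R)^nat) :
  (forall n, 0 <= u n)%E ->
  (forall e : R, 0 < e -> \forall n \near \oo, (u n <= e%:E)%E) ->
  limn_esup u = 0%E.
Proof.
move=> u0 usmall; apply/eqP; rewrite eq_le; apply/andP; split; last first.
  by apply: limf_esup_ge0 => // -[N _ /(_ N (leqnn N))].
apply/lee_addgt0Pr => e e0; rewrite add0e; apply: ge_ereal_inf.
exists (ereal_sup (u @` [set n | (u n <= e%:E)%E])).
  by exists [set n | (u n <= e%:E)%E] => //; exact: usmall.
by apply: ge_ereal_sup => _ [n le_n <-].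
Qed.

Theorem proposition4p2 (R : realType)
    (H : completeNormedModType R) (dot : {dot H for idfun})
    (Hdot : induces_norm dot)
    (L : set H) (L0 : L !=set0) (Lclosed : closed L) (Lconvex : convex_set L)
    (dO dS dQ : measure_display)
    (Omega : measurableType dO) (P : probability Omega R)
    (S : measurableType dS) (X : nat -> {RV P >-> S})
    (theta0 : H) (thetahat : forall n : nat, n.-tuple S -> H)
    (r : nat -> R) (r_nondecr : nondecreasing_seq r)
    (r_infty : r n @[n --> \oo] --> +oo)
    (OmegaQ : measurableType dQ) (Q : probability OmegaQ R)
    (G0 : {RV Q >-> borel H}) (G0_tight : tight G0)
    (eps : nat -> R) (eps_gt0 : forall n, 0 < eps n) :
  let that n w : H := thetahat n [tuple X i w | i < n] in
  cvg_in_distribution P (fun n w => r n *: (that n w - theta0)) G0 ->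
  (nonincreasing_seq eps -> eps n @[n --> \oo] --> (0 : R) ->
   nondecreasing_seq (fun n => eps n * r n) ->
   eps n * r n @[n --> \oo] --> +oo ->
   forall K : set H, compact K -> forall e : R, 0 < e ->
     limn_esup (fun n => outer_probability P
       [set w | (e%:E < ereal_sup
          [set `|dphi_hat L (eps n) (that n w) h - dphi L theta0 h|%:E
            | h in enlargement K delta])%E]) @[delta --> 0^'+]
     --> 0%E)
  /\ (forall h1 h2 : H,
        dphi L theta0 (h1 + h2) <= dphi L theta0 h1 + dphi L theta0 h2).

Proof.
move=> that ZG; split; last exact: (dphi_subadditive Hdot).
move=> _ eps_cvg _ er_infty K Kc e e0.
have [eps0 eps0_gt0 approx] :=
  dphi_hat_approx Hdot L0 Lclosed Lconvex theta0 Kc e0.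
(* The upper limit in [n] already vanishes for every positive [delta <= e / 4], a threshold
   independent of [n]. *)
apply: cvg_near_cst; have e4 : 0 < e / 4 by rewrite divr_gt0.
near=> delta; apply: limn_esup_eq0 => [n|a a0].
  exact: outer_probability_ge0.
have tail := outer_probability_tail ZG G0_tight er_infty a0.
have r_gt0 : \forall n \near \oo, 0 < r n by move/cvgryPgt : r_infty; exact.
have eps_small : \forall n \near \oo, eps n <= eps0.
  exact: (cvgr_le _ eps_cvg).
near=> n; apply: (@le_trans _ _ (outer_probability P
    [set w | eps n * r n < `|r n *: (that n w - theta0)|])); last by near: n.
(* By contraposition: off the tail event, dividing by [r n > 0] puts [that n w] within [eps n] of
   [theta0], so [approx] bounds the supremum by [e]. *)
apply: le_outer_probability => w /=; apply: contraPT; rewrite -leNgt.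
have rn : 0 < r n by near: n.
rewrite normrZ gtr0_norm// mulrC ler_pM2r// => near_that; apply/negP.
rewrite -leNgt; apply: ge_ereal_sup => _ [h Kh <-]; rewrite lee_fin.
have de : delta <= e / 4 by near: delta; exact: nbhs_right_le.
by apply: (approx _ delta) => //; near: n.
Unshelve. all: by end_near. Qed.
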